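(* Let $L,M$ be nonnegative integers and $(a,b)$ a pair of coprime integers with $1\leq b<a$, and let $n$ be the order of $\mathrm{cf}(a,b)$. (i) If either $a<2b$ and $n$ is even, or $a>2b$ and $n$ is odd, then \[ \sum_{j\in\mathbb{Z}}(-1)^j q^{\frac{1}{2}j((2ab+1)j+4\bar ab+1)+\bar a\bar b}\mathcal{B}(L,M,aj+\bar a,bj+\bar b)=H_{a,b}(L,M). \] (ii) If either $a<2b$ and $n$ is odd, or $a\ge 2b$ and $n$ is even, then \[ \sum_{j\in\mathbb{Z}}(-1)^j q^{\frac{1}{2}j((2ab+1)j+4a\bar b+1)+\bar a\bar b}\mathcal{B}(L,M,aj+\bar a,bj+\bar b)=H_{a,b}(L,M). \]
   Context: Notation: $(x;q)_n=\prod_{i=0}^{n-1}(1-xq^i)$, $(q)_n=(q;q)_n$; $\begin{bmatrix}N\\ m\end{bmatrix}=\frac{(q)_N}{(q)_m(q)_{N-m}}$ if $m,N-m$ are nonnegative integers, $0$ otherwise. $\mathcal{B}(L,M,a,b)=\begin{bmatrix}L+M+a-b\\ L+a\end{bmatrix}\begin{bmatrix}L+M-a+b\\ L-a\end{bmatrix}$. Continued-fraction data: for coprime $1\le b<a$ let $\mathrm{cf}(a,b)=(a/b-1)^{s}$ with $s=1$ if $a>2b$, $s=-1$ if $a<2b$, $s=0$ if $a=2b$. Write $\mathrm{cf}(a,b)=[a_0,\dots,a_n]$ (regular continued fraction with positive integer partial quotients), with $a_n\ge 2$ when $(a,b)\ne(2,1)$ and $\mathrm{cf}(2,1)=[1]$;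 $n$ is the order. Put $t_0=0$, $t_j=a_0+\dots+a_{j-1}$ ($1\le j\le n+1$), $d=t_{n+1}$. $\mathcal I$ is the $d\times d$ matrix with $\mathcal I_{j,k}=\delta_{j,k+1}+\delta_{j,k-1}$ if $j\notin\{t_1,\dots,t_{n+1}\}$ and $\delta_{j,k+1}+\delta_{j,k}-\delta_{j,k-1}$ otherwise; $C=2I-\mathcal I$. $\tau_j=2$ for $j<d$, $\tau_d=1$. For $m\in\mathbb Z_{\ge0}^d$: $m^TCm=\sum_{j,k}m_jC_{j,k}m_k$, $n_j=L\delta_{j,1}-\sum_kC_{j,k}m_k$, $A_m=2m_d-2m_{d-1}+1$. The pair $(\bar a,\bar b)$: $(\bar a,\bar b)=(1,0)$ if $b=1$; $(\bar a,\bar b)=(1,1)$ if $b=a-1$ and $a>2$; otherwise ($n\ge1$) $\bar a,\bar b$ are the coprime positive integers with $\bar a/\bar b=[1,a_0,\dots,a_{n-1}]$ if $a<2b$ and $\bar a/\bar b=[a_0+1,a_1,\dots,a_{n-1}]$ if $a>2b$. $H_{2,1}(L,M)=\sum_{k\ge0}q^{k^2}\begin{bmatrix}2L+M-k-1\\ 2L-1\end{bmatrix}\begin{bmatrix}L-1\\ k\end{bmatrix}$. For $(a,b)\ne(2,1)$: if $a<2b$, $H_{a,b}(L,M)=\sum_{m\in\mathbb Z_{\ge0}^d}q^{m^TCm+A_m}\begin{bmatrix}2L+M-m_1\\ 2L\end{bmatrix}\prod_{j=1}^d\begin{bmatrix}\tau_jm_j+n_j-\delta_{j,d}\\ \tau_jm_j-\delta_{j,d-1}\end{bmatrix}$;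 if $a>2b$, $H_{a,b}(L,M)=\sum_{m\in\mathbb Z_{\ge0}^d}q^{L(L-2m_1)+m^TCm+A_m}\begin{bmatrix}L+M+m_1\\ 2L\end{bmatrix}\prod_{j=1}^d\begin{bmatrix}\tau_jm_j+n_j-\delta_{j,d}\\ \tau_jm_j-\delta_{j,d-1}\end{bmatrix}$. *)

(* Defs.v *)
From HB Require Import structures.
From mathcomp Require Import all_boot all_order all_algebra.
From mathcomp Require Import fraction.
From mathcomp Require Import classical_sets fsbigop.
Set Implicit Arguments. Unset Strict Implicit. Unset Printing Implicit Defensive.
Import Order.TTheory GRing.Theory Num.Theory.
Local Open Scope ring_scope.

Definition Kq : fieldType := {fraction {poly int}}.
Definition q : Kq := @FracField.tofrac {poly int} 'X.

Definition qpoch (n : nat) : Kq := \prod_(i < n) (1 - q ^+ i.+1).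

Definition qbin (N m : int) : Kq :=
  if (0 <= m) && (m <= N) then
    qpoch `|N|%N / (qpoch `|m|%N * qpoch `|N - m|%N)
  else 0.

Definition BB (L M : nat) (a b : int) : Kq :=
  qbin (L%:Z + M%:Z + a - b) (L%:Z + a) * qbin (L%:Z + M%:Z - a + b) (L%:Z - a).

Fixpoint cfval (s : seq nat) : rat :=
  match s with
  | [::] => 0
  | [:: x] => x%:R
  | x :: s' => x%:R + (cfval s')^-1
  end.

Definition cfx (a b : nat) : rat :=
  let x := (a%:R / b%:R - 1 : rat) in
  if (2 * b < a)%N then x else if (a < 2 * b)%N then x^-1 else 1.

Definition is_cf (a b : nat) (cfs : seq nat) : Prop :=
  [/\ cfs != [::], all (fun x => 0 < x)%N cfs, cfval cfs = cfx a b &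
      if (a == 2%N) && (b == 1%N) then cfs = [:: 1%N]
      else (2 <= last 0%N cfs)%N].

Definition cforder (cfs : seq nat) : nat := (size cfs).-1.

Definition tpos (cfs : seq nat) (j : nat) : nat := \sum_(i < j) nth 0%N cfs i.
Definition dd (cfs : seq nat) : nat := tpos cfs (size cfs).
Definition inT (cfs : seq nat) (j : nat) : bool :=
  has (fun k => j == tpos cfs k) (iota 1 (size cfs)).

Definition barval (a b : nat) (cfs : seq nat) : rat :=
  let n := cforder cfs in
  if (a < 2 * b)%N then cfval (1%N :: take n cfs)
  else cfval ((head 0%N cfs).+1 :: take n.-1 (behead cfs)).
Definition abar (a b : nat) (cfs : seq nat) : int :=
  if b == 1%N then 1 else if (b == a.-1) && (2 < a)%N then 1
  else numq (barval a b cfs).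
Definition bbar (a b : nat) (cfs : seq nat) : int :=
  if b == 1%N then 0 else if (b == a.-1) && (2 < a)%N then 1
  else denq (barval a b cfs).

(* matrices, indices j, k range over 1..d *)
Definition delta (j k : nat) : int := (j == k)%:R.
Definition calI (cfs : seq nat) (j k : nat) : int :=
  if inT cfs j then delta j k.+1 + delta j k - delta j k.-1 * (0 < k)%:R
  else delta j k.+1 + delta j k.-1 * (0 < k)%:R.
Definition Cm (cfs : seq nat) (j k : nat) : int := 2 * delta j k - calI cfs j k.
Definition tau (cfs : seq nat) (j : nat) : int := if (j < dd cfs)%N then 2 else 1.

(* m is represented by the sequence [m_1; ...; m_d] (of size d) *)
Definition mc (m : seq nat) (j : nat) : int := (nth 0%N m j.-1)%:Z.
Definition quadC (cfs : seq nat) (m : seq nat) : int :=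
  \sum_(1 <= j < (dd cfs).+1) \sum_(1 <= k < (dd cfs).+1)
     mc m j * Cm cfs j k * mc m k.
Definition nvec (cfs : seq nat) (L : nat) (m : seq nat) (j : nat) : int :=
  L%:Z * delta j 1 - \sum_(1 <= k < (dd cfs).+1) Cm cfs j k * mc m k.
Definition Am (cfs : seq nat) (m : seq nat) : int :=
  2 * mc m (dd cfs) - 2 * mc m (dd cfs).-1 + 1.

Definition prodbin (cfs : seq nat) (L : nat) (m : seq nat) : Kq :=
  let d := dd cfs in
  \prod_(1 <= j < d.+1)
    qbin (tau cfs j * mc m j + nvec cfs L m j - delta j d)
         (tau cfs j * mc m j - delta j d.-1).

Local Open Scope classical_set_scope.

Definition H21 (L M : nat) : Kq :=
  \sum_(k \in [set: nat])
    q ^+ (k * k) * qbin (2 * L%:Z + M%:Z - k%:Z - 1) (2 * L%:Z - 1)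
                 * qbin (L%:Z - 1) k%:Z.

Definition Hab (a b : nat) (cfs : seq nat) (L M : nat) : Kq :=
  let d := dd cfs in
  if (a == 2%N) && (b == 1%N) then H21 L M
  else if (a < 2 * b)%N then
    \sum_(m \in [set m : seq nat | size m = d])
      q ^ (quadC cfs m + Am cfs m)
        * qbin (2 * L%:Z + M%:Z - mc m 1) (2 * L%:Z) * prodbin cfs L m
  else
    \sum_(m \in [set m : seq nat | size m = d])
      q ^ (L%:Z * (L%:Z - 2 * mc m 1) + quadC cfs m + Am cfs m)
        * qbin (L%:Z + M%:Z + mc m 1) (2 * L%:Z) * prodbin cfs L m.

(* exponents in (i) and (ii) (the numerator is always even) *)
Definition expo1 (a b : nat) (cfs : seq nat) (j : int) : int :=
  ((j * ((2 * a%:Z * b%:Z + 1) * j + 4 * abar a b cfs * b%:Z + 1)) %/ 2)%Z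
  + abar a b cfs * bbar a b cfs.
Definition expo2 (a b : nat) (cfs : seq nat) (j : int) : int :=
  ((j * ((2 * a%:Z * b%:Z + 1) * j + 4 * a%:Z * bbar a b cfs + 1)) %/ 2)%Z
  + abar a b cfs * bbar a b cfs.

Definition LHSsum (expo : int -> int) (a b : nat) (cfs : seq nat) (L M : nat) : Kq :=
  \sum_(j \in [set: int])
    (-1) ^ j * q ^ (expo j)
      * BB L M (a%:Z * j + abar a b cfs) (b%:Z * j + bbar a b cfs).

(* Main.v *)
(** The Burge transform
      [sum_i q^(i^2) [2L+M-i, 2L] B(L-i,i,a,b) = q^(b^2) B(L,M,a+b,b)]  (for [a b >= 0]),
    an instance of the q-Saalschütz sum, combined with the symmetry
    [B(L,M,a,b) = B(M,L,b,a)], turns an identity for the pair [(a,b)] into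
    identities for [(a+b,b)] and [(a+b,a)].  On the bosonic side these steps
    are [a/b -> 1 + a/b] and [a/b -> 1 + b/a], i.e. the continued fraction
    algorithm; on the fermionic side each step adds one summation variable
    (the new [m_1]) and hence one row to the matrix [C].  All pairs are reached
    in this way from [(2,1)].  The identity for [(2,1)] is itself the Burge
    transform of a two-term evaluation for [(1,1)], which follows from the limit
    [c -> oo] of the q-Dixon sum. *)
Require Import Defs.
From HB Require Import structures.
From mathcomp Require Import all_boot all_order all_algebra.
From mathcomp Require Import fraction classical_sets fsbigop.
From mathcomp Require Import zify ring.
Set Implicit Arguments. Unset Strict Implicit. Unset Printing Implicit Defensive.
Import Order.TTheory GRing.Theory Num.Theory.
Local Open Scope ring_scope.

(** * Rearrangement of finite sums, and triangular numbers *)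

Lemma sum_triangle (R : nmodType) m (f : nat -> nat -> R) :
  \sum_(r < m.+1) \sum_(s < (m - r).+1) f r s =
  \sum_(t < m.+1) \sum_(r < t.+1) f r (t - r)%N.
Proof.
elim: m f => [|m IH] f.
by do 3 rewrite ?big_ord1 /= ?subnn.
rewrite big_ord_recl [RHS]big_ord_recl /=.
rewrite [X in _ = _ + X](eq_bigr (fun t : 'I_m.+1 =>
  f 0%N t.+1 + \sum_(r < t.+1) f r.+1 (t - r)%N)); last first.
  by move=> i _; rewrite big_ord_recl.
rewrite big_split /= subn0 big_ord_recl -!addrA [X in _ = X + _]big_ord_recl big_ord0 addr0.
congr (_ + _); congr (_ + _).
rewrite -(IH (fun r s => f r.+1 s)); apply: eq_bigr => i _.
by rewrite /bump /= add1n subSS.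
Qed.

(** Both ranges are padded with zeros up to [maxn hi hi'], so only their common part has to be
    compared. *)
Lemma eq_big_nat_supp (R : nmodType) (f g : nat -> R) lo hi lo' hi' :
  (forall i, (lo <= i < hi)%N -> ~~ (lo' <= i < hi')%N -> f i = 0) ->
  (forall i, (lo' <= i < hi')%N -> ~~ (lo <= i < hi)%N -> g i = 0) ->
  (forall i, (lo <= i < hi)%N -> (lo' <= i < hi')%N -> f i = g i) ->
  \sum_(lo <= i < hi) f i = \sum_(lo' <= i < hi') g i.
Proof.
move=> f0 g0 fg.
have E (h : nat -> R) a b N : (b <= N)%N ->
    \sum_(a <= i < b) h i = \sum_(0 <= i < N) if (a <= i < b)%N then h i else 0.
  move=> bN; rewrite -big_mkcond /=.
  rewrite (big_nat_widen _ _ _ _ _ bN) (big_nat_widenl _ 0) //.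
  by apply: eq_bigl => i; rewrite andbC.
rewrite (E f lo hi (maxn hi hi')) ?leq_maxl // (E g lo' hi' (maxn hi hi')) ?leq_maxr //.
apply: eq_bigr => i _; have := f0 i; have := g0 i; have := fg i.
by case: ifP => _; case: ifP => _ a b c; [exact: a|exact: c|rewrite b|].
Qed.

Lemma big_nat_subn (R : nmodType) (g : nat -> R) b n :
  \sum_(0 <= i < n - b) g i = \sum_(b <= i < n) g (i - b)%N.
Proof. by rewrite -{2}[b]add0n big_addn; apply: eq_bigr => i _; rewrite addnK. Qed.

Definition zrange (N : nat) : seq int := [seq i%:Z - N%:Z | i <- iota 0 (N + N).+1].

Lemma mem_zrange N j : (j \in zrange N) = (`|j| <= N)%N.
Proof.
apply/mapP/idP => [[i]|jN]; first by rewrite mem_iota => iN ->; lia.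
by exists (absz (j + N%:Z)); rewrite ?mem_iota; lia.
Qed.

Lemma zrange_uniq N : uniq (zrange N).
Proof. by rewrite map_inj_uniq ?iota_uniq // => i j; lia. Qed.

(** The division is exact by [tri2]. The exponents of the theorem are [tri j] plus terms that need
    no halving. *)
Definition tri (j : int) : int := (j * (j + 1) %/ 2)%Z.

Lemma tri2 j : 2 * tri j = j * (j + 1).
Proof.
have [k [->|->]] : exists k, j = 2 * k \/ j = 2 * k + 1 by exists (j %/ 2)%Z; lia.
  by rewrite /tri -mulrA mulKz.
have -> : (2 * k + 1) * (2 * k + 1 + 1) = 2 * ((2 * k + 1) * (k + 1)) :> int by ring.
by rewrite /tri [X in (X %/ 2)%Z](_ : _ = 2 * ((2 * k + 1) * (k + 1))) ?mulKz //; ring.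
Qed.

(** * q-binomial coefficients and the Burge transform *)

Section QSeries.

Variables (F : fieldType) (q : F).
Hypothesis q_neq0 : q != 0.
Hypothesis qX_neq1 : forall n, 1 - q ^+ n.+1 != 0.

(** The field is arbitrary, with q nonzero and not a root of unity. At the [q] of the statement,
    [qbinom] is convertible to [qbin]. *)
Definition poch (n : nat) : F := \prod_(i < n) (1 - q ^+ i.+1).

Definition qbinom (N m : int) : F :=
  if (0 <= m) && (m <= N) then
    poch `|N|%N / (poch `|m|%N * poch `|N - m|%N)
  else 0.

Lemma pochS n : poch n.+1 = poch n * (1 - q ^+ n.+1).
Proof. by rewrite /poch big_ord_recr. Qed.

Lemma poch0 : poch 0 = 1.
Proof. by rewrite /poch big_ord0. Qed.

Lemma poch_neq0 n : poch n != 0.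
Proof. by rewrite /poch; apply/prodf_neq0 => i _; exact: qX_neq1. Qed.

Definition gb (n k : nat) : F := qbinom n%:Z k%:Z.

Lemma gbE n k : (k <= n)%N -> gb n k = poch n / (poch k * poch (n - k)).
Proof. by move=> kn; rewrite /gb /qbinom lez_nat kn subzn. Qed.

Lemma gb_small n k : (n < k)%N -> gb n k = 0.
Proof. by move=> nk; rewrite /gb /qbinom lez_nat leqNgt nk. Qed.

Lemma gb0 n : gb n 0 = 1.
Proof. by rewrite gbE // subn0 poch0 mul1r divff // poch_neq0. Qed.

Lemma gbnn n : gb n n = 1.
Proof. by rewrite gbE // subnn poch0 mulr1 divff // poch_neq0. Qed.

Lemma gb_sub n k : (k <= n)%N -> gb n (n - k) = gb n k.
Proof. by move=> kn; rewrite !gbE ?leq_subr // subKn // [poch k * _]mulrC. Qed.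

(** One of the two q-Pascal rules; the other, [gbS'], follows from it by the symmetry k -> n - k. *)
Lemma gbS n k : gb n.+1 k.+1 = gb n k.+1 + q ^+ (n - k) * gb n k.
Proof.
case: (ltngtP k n) => [kn|nk|->]; last first.
- by rewrite !gbnn gb_small // subnn expr0 mulr1 add0r.
- by rewrite !gb_small ?mulr0 ?addr0 // ltnS ltnW.
have kn' := ltnW kn; rewrite !gbE //.
have [p ->] : exists p, n = (k + p.+1)%N by exists (n - k).-1; lia.
have -> : ((k + p.+1).+1 - k.+1 = p.+1)%N by lia.
have -> : (k + p.+1 - k.+1 = p)%N by lia.
have -> : (k + p.+1 - k = p.+1)%N by lia.
have -> : (k + p.+1).+1 = (k.+1 + p.+1)%N by lia.
rewrite addSn (pochS (k + p.+1)) (pochS k) (pochS p) -addSn.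
move: (poch_neq0 k) (poch_neq0 p) (qX_neq1 k) (qX_neq1 p).
rewrite exprD.
set Q := poch (_ + _).
move: (poch k) (poch p) Q (q ^+ _) (q ^+ _) => x y z u v hx hy hu hv.
field.
by rewrite hx hy hu hv.
Qed.

Lemma gbS' n k : gb n.+1 k.+1 = q ^+ k.+1 * gb n k.+1 + gb n k.
Proof.
case: (ltngtP k n) => [kn|nk|->]; last first.
- by rewrite !gbnn gb_small // mulr0 add0r.
- by rewrite !gb_small ?mulr0 ?addr0 // ltnS ltnW.
rewrite -(gb_sub (n := n.+1)) ?ltnS 1?ltnW // subSS.
have -> : (n - k = (n - k.+1).+1)%N by lia.
rewrite gbS -subSn // subSS gb_sub 1?ltnW // gb_sub //.
have -> : (n - (n - k.+1) = k.+1)%N by lia.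
by rewrite addrC.
Qed.

(** Induction on A, with [gbS] applied on both sides. Where the subtraction in the exponent
    truncates, [gb B (n - k)] vanishes. *)
Lemma q_vandermonde A B n :
  \sum_(k < n.+1) q ^+ (k * (B - (n - k))) * gb A k * gb B (n - k) = gb (A + B) n.
Proof.
elim: A n => [|A IH] n.
  rewrite big_ord_recl gb0 mul0n expr0 !mul1r subn0 add0n big1 ?addr0 // => i _.
  by rewrite (@gb_small 0) // mulr0 mul0r.
case: n => [|n].
  by rewrite big_ord_recl big_ord0 /= addr0 !gb0 mul0n expr0 !mulr1.
rewrite addSn gbS -IH -(IH n) big_ord_recl [X in _ = X + _]big_ord_recl !gb0 -addrA.
congr (_ + _).
rewrite mulr_sumr -big_split /=; apply: eq_bigr => i _.
rewrite /bump /= !add1n subSS gbS.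
have [lt|le] := ltnP B (n - i); first by rewrite (gb_small lt) !(mulr0, mul0r) addr0.
have [lt|leA] := ltnP A i.
  by rewrite (gb_small lt) (@gb_small A i.+1) 1?ltnW // !(mulr0, mul0r, addr0).
rewrite mulrDr mulrDl; congr (_ + _).
rewrite !mulrA -!exprD; congr (q ^+ _ * _ * _).
by case: i le leA => i /=; rewrite ltnS => ltin; nia.
Qed.

(** Both sides equal (q)_A / ((q)_l (q)_(k-l) (q)_(A-k)) for l <= k; the factor [(l <= k)%:R]
    discards a truncated [k - l]. *)
Lemma gb_trinomial A k l : (k <= A)%N ->
  gb A l * gb (A - l) (k - l) * (l <= k)%:R = gb A k * gb k l.
Proof.
move=> kA; case: leqP => [lk|kl]; last by rewrite (gb_small kl) !mulr0.
have lA : (l <= A)%N by exact: leq_trans kA.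
rewrite !gbE //; last by lia.
have -> : (A - l - (k - l) = A - k)%N by lia.
move: (poch_neq0 l) (poch_neq0 k) (poch_neq0 (A - l)) (poch_neq0 (A - k)) (poch_neq0 (k - l)).
move: (poch l) (poch k) (poch A) (poch (A - l)) (poch (A - k)) (poch (k - l)).
move=> a b c d e f ha hb hd he hf.
by rewrite mulr1; field; rewrite ha hb hd he hf.
Qed.

(** This is [q_vandermonde] for A = t, B = y, n = t + c, summed over r = t - k; the terms with k > t
    vanish. *)
Lemma q_vandermonde_rev t y c :
  \sum_(r < t.+1) q ^+ ((t - r) * (y - (r + c))) * gb t r * gb y (r + c) = gb (y + t) (t + c).
Proof.
rewrite addnC -q_vandermonde (big_ord_widen_cond (t + c).+1 xpredT
  (fun r => q ^+ ((t - r) * (y - (r + c))) * gb t r * gb y (r + c))); last by rewrite ltnS leq_addr.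
rewrite -(big_mkord (fun r => r < t.+1)%N
  (fun r => q ^+ ((t - r) * (y - (r + c))) * gb t r * gb y (r + c))).
rewrite -(big_mkord xpredT (fun k => q ^+ (k * (y - (t + c - k))) * gb t k * gb y (t + c - k))).
rewrite (big_cat_nat (n := t.+1)) //=; last by rewrite ltnS leq_addr.
rewrite [X in _ + X]big1_seq ?addr0; last first.
  by move=> i; rewrite mem_index_iota => /andP[a /andP[b _]]; lia.
rewrite [RHS](big_cat_nat (n := t.+1)) //=; last by rewrite ltnS leq_addr.
rewrite [X in _ = _ + X]big1_seq ?addr0; last first.
  by move=> i; rewrite mem_index_iota => /andP[_ /andP[ti _]]; rewrite (gb_small ti) mulr0 mul0r.
rewrite big_mkcond big_nat_rev /= add0n; apply: eq_big_nat => i /andP[_ it].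
rewrite subSS ltnS leq_subr -gb_sub ?leq_subr // subKn //.
by have -> : (t - i + c = t + c - i)%N by lia.
Qed.

(* q-Saalschütz: expanding by the q-Vandermonde sum turns both sides into
   the sum over t of q^(t(t+c)) [x,t] [y+m,m-t] [y+t,t+c]. *)
Lemma q_saalschutz x y c m :
  \sum_(r < m.+1) q ^+ (r * (r + c)) * gb x r * gb y (r + c) * gb (x + y + m - r) (m - r)
  = gb (x + c + m) m * gb (y + m) (m + c).
Proof.
transitivity (\sum_(t < m.+1)
  q ^+ (t * (t + c)) * gb x t * gb (y + m) (m - t) * gb (y + t) (t + c)).
  transitivity (\sum_(r < m.+1) \sum_(s < (m - r).+1)
     gb x (r + s) * gb (y + m) (m - (r + s)) *
       (q ^+ (r * (r + c) + s * (y + (r + s))) * gb (r + s) r * gb y (r + c))).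
    apply: eq_bigr => r _; have rm : (r <= m)%N by rewrite -ltnS.
    have [xr|rx] := ltnP x r.
      rewrite (gb_small xr) !(mulr0, mul0r) big1 // => s _.
      by rewrite gb_small ?mul0r // (leq_trans xr) // leq_addr.
    have -> : (x + y + m - r = (x - r) + (y + m))%N by lia.
    rewrite -q_vandermonde mulr_sumr; apply: eq_bigr => s _.
    have sm : (s <= m - r)%N by rewrite -ltnS.
    have -> : (y + m - (m - r - s) = y + (r + s))%N by lia.
    have -> : (m - r - s = m - (r + s))%N by lia.
    have [xs|sx] := ltnP x (r + s).
      by rewrite (gb_small xs) (@gb_small (x - r)) ?mul0r ?mulr0 ?mul0r ?mulr0 //; lia.
    have := gb_trinomial r sx; rewrite leq_addr mulr1 addKn => e.
    rewrite exprD.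
    have -> : forall a b p u v w : F, a * p * u * (b * v * w) = (p * v) * w * (a * b * u)
      by move=> *; ring.
    by rewrite e; ring.
  apply: (etrans (sum_triangle m (fun r s => gb x (r + s) * gb (y + m) (m - (r + s)) *
     (q ^+ (r * (r + c) + s * (y + (r + s))) * gb (r + s) r * gb y (r + c))))) => /=.
  apply: eq_bigr => t _.
  rewrite -q_vandermonde_rev mulr_sumr; apply: eq_bigr => r _.
  have rt : (r <= t)%N by rewrite -ltnS.
  rewrite subnKC //.
  have [lt|le] := ltnP y (r + c); first by rewrite (gb_small lt) !mulr0.
  have -> : (r * (r + c) + (t - r) * (y + t) = t * (t + c) + (t - r) * (y - (r + c)))%N.
    by nia.
  by rewrite exprD; ring.
have [yc|cy] := ltnP y c.
  rewrite big1 ?(@gb_small (y + m)) ?mulr0 // => [|i _]; first by lia.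
  by rewrite (@gb_small (y + i)) ?mulr0 //; lia.
rewrite -[(x + c + m)%N]addnA -q_vandermonde mulr_suml; apply: eq_bigr => t _.
have tm : (t <= m)%N by rewrite -ltnS.
have -> : (c + m - (m - t) = t + c)%N by lia.
rewrite -!mulrA; congr (_ * (_ * _)).
have -> : gb (y + m) (m - t) = gb (y + m) (y + t).
  by rewrite -(gb_sub (n := (y + m)%N)); [congr gb; lia | lia].
have -> : gb (c + m) (m - t) = gb (m + c) (t + c).
  by rewrite addnC -(gb_sub (n := (m + c)%N)); [congr gb; lia | lia].
rewrite [RHS]mulrC -!gb_trinomial; try lia.
have -> : (t + c <= y + t)%N by lia.
have -> : (t + c <= m + c)%N by lia.
rewrite !mulr1; congr (_ * _).
rewrite -(gb_sub (n := (y + m - (t + c))%N)); last by lia.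
by congr gb; lia.
Qed.

Lemma qbinom_eq0 (N m : int) : ~~ ((0 <= m) && (m <= N)) -> qbinom N m = 0.
Proof. by rewrite /qbinom => /negbTE ->. Qed.

Definition burgeB (L M : nat) (a b : int) : F :=
  qbinom (L%:Z + M%:Z + a - b) (L%:Z + a) * qbinom (L%:Z + M%:Z - a + b) (L%:Z - a).

Lemma burgeBN L M a b : burgeB L M (- a) (- b) = burgeB L M a b.
Proof. by rewrite /burgeB !opprK mulrC. Qed.

Lemma qbinom_sym N m : qbinom N (N - m) = qbinom N m.
Proof.
rewrite /qbinom subKr subr_ge0 gerBl andbC [poch `|N - m| * _]mulrC; done.
Qed.

Lemma burgeBC L M a b : burgeB M L b a = burgeB L M a b.
Proof.
rewrite /burgeB mulrC; congr (_ * _); rewrite -qbinom_sym; congr qbinom; ring.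
Qed.

(** The q-Saalschütz sum with x = L + a - b, y = L - a + b, c = 2b, m = M - b and r = i - b. The
    powers of q agree because b^2 + (i - b)(i + b) = i^2. *)
Lemma burge_nat L M a b :
  \sum_(i < L.+1) q ^+ (i ^ 2) * qbinom ((2 * L + M)%N%:Z - i%:Z) (2 * L)%N
     * burgeB (L - i) i a%:Z b%:Z
  = q ^+ (b ^ 2) * burgeB L M (a%:Z + b%:Z) b%:Z.
Proof.
rewrite -(big_mkord xpredT (fun i => q ^+ (i ^ 2) * qbinom ((2 * L + M)%N%:Z - i%:Z) (2 * L)%N
     * burgeB (L - i) i a%:Z b%:Z)).
(* If a + b > L or b > M, the right-hand side and every term vanish; otherwise the subtractions in
   these parameters are exact. *)
have [lt|leL] := ltnP L (a + b).
  rewrite [in RHS]/burgeB [X in _ = _ * (_ * X)]qbinom_eq0 ?mulr0; last by lia.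
  apply: big1_seq => i; rewrite mem_index_iota => /andP[_ /andP[_ iL]].
  rewrite /burgeB; have [ib|bi] := ltnP i b.
    by rewrite [X in _ * (X * _)]qbinom_eq0 ?(mul0r, mulr0) //; lia.
  by rewrite [X in _ * (_ * X)]qbinom_eq0 ?(mul0r, mulr0) //; lia.
have [lt|leM] := ltnP M b.
  rewrite [in RHS]/burgeB qbinom_eq0 ?(mul0r, mulr0); last by lia.
  apply: big1_seq => i; rewrite mem_index_iota => /andP[_ /andP[_ iL]].
  rewrite /burgeB; have [ib|bi] := ltnP i b.
    by rewrite [X in _ * (X * _)]qbinom_eq0 ?(mul0r, mulr0) //; lia.
  by rewrite qbinom_eq0 ?(mul0r, mulr0) //; lia.
have -> : burgeB L M (a%:Z + b%:Z) b%:Z =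
    gb ((L + a - b) + b * 2 + (M - b)) (M - b) * gb ((L - a + b) + (M - b)) ((M - b) + b * 2).
  by rewrite /burgeB; congr (_ * _); rewrite -qbinom_sym; congr qbinom; lia.
rewrite -q_saalschutz mulr_sumr.
rewrite -(big_mkord xpredT (fun r => q ^+ (b ^ 2) *
 (q ^+ (r * (r + b * 2)) * gb (L + a - b) r * gb (L - a + b) (r + b * 2) *
 gb (L + a - b + (L - a + b) + (M - b) - r) (M - b - r)))).
rewrite -subSn // big_nat_subn.
apply: eq_big_nat_supp => i H1 H2.
- rewrite /burgeB; have [ib|bi] := ltnP i b.
    by rewrite [X in _ * (X * _)]qbinom_eq0 ?(mul0r, mulr0) //; lia.
  by rewrite qbinom_eq0 ?(mul0r, mulr0) //; lia.
- by rewrite (@gb_small (L - a + b)) ?(mul0r, mulr0) //; lia.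
- rewrite !mulrA -exprD; have -> : (b ^ 2 + (i - b) * (i - b + b * 2) = i ^ 2)%N by nia.
  rewrite -!mulrA; congr (_ * _).
  rewrite [LHS]mulrC !mulrA /burgeB; congr (_ * _ * _).
  + by rewrite -qbinom_sym; congr qbinom; lia.
  + by rewrite -qbinom_sym; congr qbinom; lia.
  + by rewrite -qbinom_sym; congr qbinom; lia.
Qed.

(** Here a and b are both nonnegative or both nonpositive, and [burgeBN] reduces the second case to
    the first. *)
Lemma burge_transform L M (a b : int) : 0 <= a * b ->
  \sum_(i < L.+1) q ^+ (i ^ 2) * qbinom ((2 * L + M)%N%:Z - i%:Z) (2 * L)%N
     * burgeB (L - i) i a b
  = q ^+ (`|b| ^ 2) * burgeB L M (a + b) b.
Proof.
wlog : a b / (0 <= a) && (0 <= b).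
  move=> W ab; have [H|H] := boolP ((0 <= a) && (0 <= b)); first exact: W.
  have : (0 <= - a) && (0 <= - b) by nia.
  move=> /W; rewrite mulrNN abszN => /(_ ab).
  rewrite -opprD burgeBN => <-; apply: eq_bigr => i _; by rewrite burgeBN.
case: a => a //; case: b => b //; rewrite ?andbF // => _ _.
exact: burge_nat.
Qed.

(** * Bosonic sums over the integers *)

Definition zsum (f : int -> F) : F := \sum_(j \in [set: int]) f j.

Lemma zsumE N f : (forall j : int, (N < `|j|)%N -> f j = 0) ->
  zsum f = \sum_(j <- zrange N) f j.
Proof.
move=> f0; rewrite /zsum (fsbig_seq _ _ (zrange_uniq N)); apply/esym/fsbig_widen => // j [_ /=].
by move/negP; rewrite mem_zrange -ltnNge => /f0.
Qed.

Lemma zsum_reindex (h g : int -> int) f : cancel h g -> cancel g h -> zsum f = zsum (f \o h).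
Proof. by move=> hg gh; apply: reindex_fsbigT; exists g. Qed.

Lemma eq_zsum f g : f =1 g -> zsum f = zsum g.
Proof. by move=> fg; apply: eq_fsbigr => j _; exact: fg. Qed.

(* [1/(q)_n], with the convention [1/(q)_n = 0] for [n < 0], so that [rpoch_pred]
   holds for every integer [n]. *)
Definition rpoch (n : int) : F := if 0 <= n then (poch `|n|)^-1 else 0.

Lemma rpoch_pred n : rpoch (n - 1) = (1 - q ^ n) * rpoch n.
Proof.
rewrite /rpoch; case: n => [[|n]|n]; first by rewrite expr0z subrr mul0r.
  rewrite -addn1 PoszD addrK !lez_nat /= addn1 pochS invfM.
  by rewrite -PoszD addn1 -exprnP mulrCA divff ?mulr1 // qX_neq1.
by rewrite mulr0.
Qed.

Lemma signN (j : int) : (-1 : F) ^ (- j) = (-1) ^ j.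
Proof. by rewrite -exprz_inv invrN1. Qed.

(* [c = a' b] gives the exponent of part (i) and [c = a b'] that of part (ii);
   keeping [c] free lets one lemma serve both. *)
Definition gsum (c a b a' b' : int) (L M : nat) : F :=
  zsum (fun j => (-1) ^ j * q ^ (tri j + a * b * (j * j) + 2 * c * j + a' * b')
                 * burgeB L M (a * j + a') (b * j + b')).

(** The Burge transform of each term adds (bj + b')^2 to the exponent. This turns ab into (a + b)b,
    a'b' into (a' + b')b', and c into c + bb'. *)
Lemma gsum_burge c a b a' b' L M : 0 < b ->
  (forall j : int, 0 <= (a * j + a') * (b * j + b')) ->
  gsum (c + b * b') (a + b) b (a' + b') b' L M =
  \sum_(i < L.+1) q ^+ (i ^ 2) * qbinom ((2 * L + M)%N%:Z - i%:Z) (2 * L)%N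
     * gsum c a b a' b' (L - i) i.
Proof.
(* Since b >= 1, |j| > N forces |bj + b'| > L + M, so one range of j serves the sums on both
   sides. *)
move=> b0 ge0; pose N := (L + M + `|b'|)%N.
have supp (a1 a1' : int) L' M' : (L' <= L)%N -> (M' <= L + M)%N -> forall j : int, (N < `|j|)%N ->
    burgeB L' M' (a1 * j + a1') (b * j + b') = 0.
  move=> L'L M'M j Nj; rewrite /burgeB.
  have [H|H] : M'%:Z + (b * j + b') < 0 \/ M'%:Z - (b * j + b') < 0 by nia.
    by rewrite [X in _ * X]qbinom_eq0 ?mulr0 //; lia.
  by rewrite qbinom_eq0 ?mul0r //; lia.
rewrite /gsum (@zsumE N) => [|j Nj]; last by rewrite supp ?mulr0 // leq_addl.
under [RHS]eq_bigr => i _.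
  rewrite (@zsumE N) => [|j Nj]; last first.
    by rewrite supp ?mulr0 ?leq_subr // (leq_trans _ (leq_addr _ _)) // -ltnS.
  rewrite mulr_sumr.
over.
rewrite exchange_big /=; apply: eq_bigr => j _.
have -> : (a + b) * j + (a' + b') = (a * j + a') + (b * j + b') by ring.
transitivity ((-1) ^ j * q ^ (tri j + a * b * (j * j) + 2 * c * j + a' * b') *
   (q ^+ (`|b * j + b'| ^ 2) * burgeB L M (a * j + a' + (b * j + b')) (b * j + b'))).
  rewrite -mulrA [q ^+ _]exprnP mulrA [RHS]mulrA -[X in _ = X * _]mulrA -expfzDr //.
  congr (_ * q ^ _ * _).
  have E (x : int) : Posz (absz x ^ 2)%N = x * x by nia.
  by rewrite E; ring.
rewrite -burge_transform // mulr_sumr; apply: eq_bigr => i _; ring.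
Qed.

Lemma gsumC c a b a' b' L M : gsum c b a b' a' M L = gsum c a b a' b' L M.
Proof.
apply: eq_zsum => j; rewrite burgeBC; congr (_ * q ^ _ * _); ring.
Qed.

Lemma gsum_burge_swap c a b a' b' L M : 0 < a ->
  (forall j : int, 0 <= (a * j + a') * (b * j + b')) ->
  gsum (c + a * a') (a + b) a (a' + b') a' L M =
  \sum_(i < L.+1) q ^+ (i ^ 2) * qbinom ((2 * L + M)%N%:Z - i%:Z) (2 * L)%N
     * gsum c a b a' b' i (L - i).
Proof.
move=> a0 ge0; rewrite [a + b]addrC [a' + b']addrC gsum_burge // => [|j]; last by rewrite mulrC.
by apply: eq_bigr => i _; rewrite gsumC.
Qed.

(** * The identity for (a,b) = (2,1) *)

Hypothesis two_neq0 : 2%:R != 0 :> F.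

(* [dixon L M 0] is the limiting case c -> oo of the q-Dixon sum
   (its value is [dixon0]); the twists by q^(kj) are reduced to it. *)
Definition dixon_term (L M k j : int) : F :=
  (-1) ^ j * q ^ (tri j + j * j) * (q ^ j) ^ k *
  (rpoch (L + j) * rpoch (L - j) * rpoch (M + j) * rpoch (M - j)).

Definition dixon (L M k : int) : F := zsum (dixon_term L M k).

Lemma rpoch_lt0 n : n < 0 -> rpoch n = 0.
Proof. by rewrite /rpoch leNgt => ->. Qed.

Lemma dixon_term_supp L M k j : (`|M| < `|j|)%N -> dixon_term L M k j = 0.
Proof.
move=> Mj; rewrite /dixon_term; have [H|H] : M + j < 0 \/ M - j < 0 by lia.
  by rewrite (rpoch_lt0 H) !(mulr0, mul0r).
by rewrite (rpoch_lt0 H) !(mulr0, mul0r).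
Qed.

Lemma dixonE L M k : dixon L M k = \sum_(j <- zrange `|M|) dixon_term L M k j.
Proof. by apply: zsumE => j; apply: dixon_term_supp. Qed.

(** The substitution j -> -j. It links the twist 0 with -1, and 1 with -2. *)
Lemma dixon_opp L M k : dixon L M k = dixon L M (- 1 - k).
Proof.
rewrite /dixon (@zsum_reindex -%R -%R); [|exact: opprK|exact: opprK].
apply: eq_zsum => j /=; rewrite /dixon_term signN opprK !exprz_exp.
have -> : tri (- j) + - j * - j = tri j + j * j - j by have := tri2 j; have := tri2 (- j); nia.
have -> : j * (-1 - k) = - j + - j * k by ring.
rewrite [q ^ (- j + _)]expfzDr // [q ^ (_ - j)]expfzDr //.
by ring.
Qed.

(** This is (1 - q^(L+j)) (1 - q^(M+j)) times [dixon_term L M (-2) j], so that j -> 1 - j permutes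
    the [rpoch] factors. *)
Definition refl_term (L M j : int) : F :=
  (-1) ^ j * q ^ (tri j + j * j) * (q ^ j) ^ (-2) *
  (rpoch (L - 1 + j) * rpoch (L - j) * rpoch (M - 1 + j) * rpoch (M - j)).

(* The reflection [j -> 1 - j] changes the sign of the summand. *)
Lemma zsum_refl L M : zsum (refl_term L M) = 0.
Proof.
have E : zsum (refl_term L M) = - zsum (refl_term L M).
  rewrite {1}/zsum -mulN1r /zsum mulr_fsumr -/(zsum _) -/(zsum _).
  rewrite (@zsum_reindex (fun j => 1 - j) (fun j => 1 - j)); try by move=> j; rewrite subKr.
  apply: eq_zsum => j /=; rewrite /refl_term.
  rewrite [(-1) ^ (1 - j)]expfzDr ?oppr_eq0 ?oner_eq0 // signN !exprz_exp.
  have -> : L - 1 + (1 - j) = L - j by ring.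
  have -> : M - 1 + (1 - j) = M - j by ring.
  have -> : L - (1 - j) = L - 1 + j by ring.
  have -> : M - (1 - j) = M - 1 + j by ring.
  have e : tri (1 - j) + (1 - j) * (1 - j) + (1 - j) * -2 = tri j + j * j + j * -2.
    by have := tri2 j; have := tri2 (1 - j); nia.
  have /(congr1 (fun k => q ^ k)) := e; rewrite expfzDr // [in RHS]expfzDr // => e'.
  by rewrite expr1z -[X in X * _ = _]mulrA e'; ring.
have : 2%:R * zsum (refl_term L M) = 0 by rewrite mulr_natl mulr2n {1}E addNr.
by move/eqP; rewrite mulf_eq0 (negbTE two_neq0) => /eqP.
Qed.

Lemma exprzN2 (z : F) : z ^ (-2) = (z * z)^-1.
Proof. by []. Qed.

(** Expanding (1 - q^(L+j)) (1 - q^(M+j)) in [refl_term] turns [zsum_refl] into a relation between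
    three twists. *)
Lemma dixon_contiguous L M :
  dixon L M (-2) - (q ^ L + q ^ M) * dixon L M (-1) + q ^ (L + M) * dixon L M 0 = 0.
Proof.
rewrite -(zsum_refl L M) !dixonE (@zsumE `|M|%N); last first.
  move=> j Mj; rewrite /refl_term; have [H|H] : M - 1 + j < 0 \/ M - j < 0 by lia.
    by rewrite (rpoch_lt0 H) !(mulr0, mul0r).
  by rewrite (rpoch_lt0 H) !(mulr0, mul0r).
rewrite !mulr_sumr -sumrB -big_split /=; apply: eq_bigr => j _.
rewrite /refl_term /dixon_term.
have -> : L - 1 + j = L + j - 1 by ring.
have -> : M - 1 + j = M + j - 1 by ring.
rewrite !rpoch_pred !(expfzDr _ _ q_neq0).
have z0 : q ^ j != 0 by rewrite expfz_neq0.
by rewrite expr0z exprN1 (exprzN2 (q ^ j)); field.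
Qed.

(** Lowering L by 1 multiplies the summand by (1 - q^(L+j)) (1 - q^(L-j)) = 1 + q^(2L) - q^L (q^j +
    q^(-j)). *)
Lemma dixon_pred L M :
  dixon (L - 1) M 0 = (1 + q ^ (L + L)) * dixon L M 0 - q ^ L * (dixon L M 1 + dixon L M (-1)).
Proof.
rewrite !dixonE !mulrDr !mulr_sumr -big_split -sumrB /=; apply: eq_bigr => j _.
rewrite /dixon_term.
have -> : L - 1 + j = L + j - 1 by ring.
have -> : L - 1 - j = L - j - 1 by ring.
rewrite !rpoch_pred !(expfzDr _ _ q_neq0) -invr_expz.
have z0 : q ^ j != 0 by rewrite expfz_neq0.
by rewrite expr0z expr1z exprN1; field.
Qed.

Lemma dixon_m1 L M : dixon L M (-1) = dixon L M 0.
Proof. by rewrite dixon_opp. Qed.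

Lemma dixon_m2 L M : dixon L M (-2) = (q ^ L + q ^ M - q ^ (L + M)) * dixon L M 0.
Proof.
have := dixon_contiguous L M; rewrite dixon_m1 => /eqP.
by rewrite -addrA addr_eq0 => /eqP ->; ring.
Qed.

Lemma dixon_p1 L M : dixon L M 1 = (q ^ L + q ^ M - q ^ (L + M)) * dixon L M 0.
Proof. by rewrite dixon_opp -dixon_m2. Qed.

(** Induction on L. With the twists 1 and -1 expressed through the twist 0, [dixon_pred] says that
    passing from L to L - 1 multiplies the sum by (1 - q^L)(1 - q^(L+M)), which is nonzero for L >
    0. At L = 0 only j = 0 contributes. *)
Lemma dixon0 (L : nat) M : 0 <= M -> dixon L%:Z M 0 = rpoch L%:Z * rpoch M * rpoch (L%:Z + M).
Proof.
move=> M0; elim: L => [|L IH].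
  rewrite dixonE (bigD1_seq 0) ?zrange_uniq ?mem_zrange //=.
  rewrite big1 ?addr0 => [|j /negbTE j0]; last first.
    rewrite /dixon_term; have [H|H] : (0%N%:Z + j < 0) \/ (0%N%:Z - j < 0) by lia.
      by rewrite (rpoch_lt0 H) !(mulr0, mul0r).
    by rewrite (rpoch_lt0 H) !(mulr0, mul0r).
  rewrite /dixon_term (_ : tri 0 = 0) // mulr0 !addr0 ?subr0 !add0r !expr0z.
  by rewrite [rpoch 0](_ : _ = 1) ?mul1r // /rpoch /= poch0 invr1.
have H : (1 - q ^ (L.+1%:Z)) * (1 - q ^ (L.+1%:Z + M)) != 0.
  case: M M0 {IH} => // M _; apply: mulf_neq0; first exact: qX_neq1.
  by rewrite -PoszD -exprnP addSn qX_neq1.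
apply: (mulfI H).
have -> : (1 - q ^ L.+1) * (1 - q ^ (L.+1%:Z + M)) * dixon L.+1 M 0 = dixon (L.+1%:Z - 1) M 0.
  by rewrite dixon_pred dixon_p1 dixon_m1 !(expfzDr _ _ q_neq0); ring.
have -> : L.+1%:Z - 1 = L by lia.
rewrite IH; have -> : L%:Z = L.+1%:Z - 1 by lia.
have -> : L.+1%:Z - 1 + M = L.+1%:Z + M - 1 by ring.
by rewrite !rpoch_pred; ring.
Qed.

Lemma qbinom_rpoch (N : nat) m : qbinom N%:Z m = poch N * (rpoch m * rpoch (N%:Z - m)).
Proof.
rewrite /qbinom /rpoch subr_ge0; case: ifP => [/andP[-> ->]|/negbT]; first by rewrite invfM.
by rewrite negb_and => /orP[] /negbTE ->; rewrite ?(mulr0, mul0r).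
Qed.

Lemma poch_rpoch n : poch n * rpoch n%:Z = 1.
Proof. by rewrite /rpoch /= divff // poch_neq0. Qed.

(** Writing 1/(q)_(L-1-j) as (1 - q^(L-j)) (1 - q^(L+1-j)) / (q)_(L+1-j) splits the sum into three
    sums [dixon (L + 1) M k] with k = 0, -1, -2, all of them known multiples of the case k = 0. *)
Lemma gsum_seed L M : (0 < L + M)%N ->
  gsum 0 1 1 1 0 L M =
  qbinom ((L + M)%N%:Z - 1) (L%:Z - 1) - q ^+ (2 * L + 1) * qbinom ((L + M)%N%:Z - 1) L%:Z.
Proof.
case E : (L + M)%N => [//|N] _.
have EM : M%:Z = N%:Z + 1 - L%:Z by lia.
have -> : N.+1%:Z - 1 = N by lia.
rewrite !qbinom_rpoch.
have -> : N%:Z - (L%:Z - 1) = M by lia.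
have -> : N%:Z - L%:Z = M%:Z - 1 by lia.
transitivity (poch N.+2 * poch N * (dixon (L%:Z + 1) M 0
   - (q ^ L + q ^ (L%:Z + 1)) * dixon (L%:Z + 1) M (-1)
   + q ^ (L%:Z + (L%:Z + 1)) * dixon (L%:Z + 1) M (-2))).
  rewrite !dixonE /gsum (@zsumE M); last first.
    move=> j Mj; rewrite /burgeB; have [H|H] : M%:Z + j < 0 \/ M%:Z - j < 0 by lia.
      by rewrite [X in _ * (_ * X) = _]qbinom_eq0 ?mulr0 //; lia.
    by rewrite [X in _ * (X * _) = _]qbinom_eq0 ?(mul0r, mulr0) //; lia.
  rewrite !mulr_sumr -sumrB -big_split /= mulr_sumr; apply: eq_bigr => j _.
  rewrite /burgeB /dixon_term !mul1r.
  have -> : L%:Z + M%:Z + (j + 1) - (j + 0) = N.+2 by lia.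
  have -> : L%:Z + M%:Z - (j + 1) + (j + 0) = N by lia.
  rewrite !qbinom_rpoch.
  have -> : N.+2%:Z - (L%:Z + (j + 1)) = M%:Z - j by lia.
  have -> : N%:Z - (L%:Z - (j + 1)) = M%:Z + j by lia.
  have -> : L%:Z - (j + 1) = L%:Z + 1 - j - 1 - 1 by ring.
  have -> : L%:Z + (j + 1) = L%:Z + 1 + j by ring.
  have -> : tri j + j * j + 2 * 0 * j + 1 * 0 = tri j + j * j by ring.
  rewrite !rpoch_pred.
  have -> : L%:Z + 1 - j - 1 = L%:Z - j by ring.
  rewrite !(expfzDr _ _ q_neq0) -invr_expz.
  have z0 : q ^ j != 0 by rewrite expfz_neq0.
  by rewrite expr0z exprN1 expr1z (exprzN2 (q ^ j)); field.
rewrite dixon_m1 dixon_m2 -PoszD addn1 dixon0 // -PoszD.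
have -> : (L.+1 + M = N.+2)%N by lia.
have P := poch_rpoch N.+2.
rewrite !rpoch_pred.
have -> : rpoch L = (1 - q ^ L.+1) * rpoch L.+1 by rewrite -rpoch_pred; congr rpoch; lia.
have qS : q ^ L.+1 = q ^ L * q by rewrite exprSzr.
have -> : q ^+ (2 * L + 1) = q ^ L * q ^ L * q by rewrite -exprnP -!exprD -exprSr addn1 mul2n addnn.
have qN : q ^ N.+2 = q ^ L * q * q ^ M by rewrite -qS -expfzDr //; congr (q ^ _); lia.
rewrite !(expfzDr _ _ q_neq0) qN qS.
transitivity (poch N.+2 * rpoch N.+2 * (poch N * rpoch L.+1 * rpoch M *
  ((1 - q ^ L) * (1 - q ^ L * q) - q ^ L * q ^ L * q * ((1 - q ^ L * q) * (1 - q ^ M))))).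
  by ring.
by rewrite P; ring.
Qed.

Lemma gsum21 L M : gsum 0 2 1 1 0 L M =
  \sum_(k < L) q ^+ (k * k) * qbinom (2 * L%:Z + M%:Z - k%:Z - 1) (2 * L%:Z - 1)
    * qbinom (L%:Z - 1) k%:Z.
Proof.
have -> : gsum 0 2 1 1 0 L M = gsum (0 + 1 * 0) (1 + 1) 1 (1 + 0) 0 L M by [].
rewrite gsum_burge => [||j] //; last by nia.
(* [gsum_seed] needs (L - i) + i > 0, so L = 0 is treated apart; both sides are then zero. *)
case: L => [|L].
  rewrite big_ord0 big_ord1 [gsum _ _ _ _ _ _ _](_ : _ = 0) ?mulr0 //.
  have B0 (j : int) : burgeB 0 0 (1 * j + 1) (1 * j + 0) = 0.
    by rewrite /burgeB [X in _ * X]qbinom_eq0 ?mulr0 //; lia.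
  by rewrite /gsum (@zsumE 0) => [|j _]; [apply: big1_seq => j _|]; rewrite B0 mulr0.
transitivity (\sum_(i < L.+2) q ^+ (i ^ 2) * qbinom ((2 * L.+1 + M)%N%:Z - i%:Z) (2 * L.+1)%N *
   (qbinom L i%:Z - q ^+ (2 * (L.+1 - i) + 1) * qbinom L (i%:Z - 1))).
  apply: eq_bigr => -[i iL] _ /=; rewrite gsum_seed; last by lia.
  rewrite -[qbinom L _]qbinom_sym -[qbinom L (_ - 1)]qbinom_sym.
  by congr (_ * (qbinom _ _ - _ * qbinom _ _)); lia.
(* With i = k + 1 in the second sum, the two terms carry [N + 1, 2L + 2] and q^(2L + 2) [N, 2L + 2],
   where N = 2L + M + 1 - k; by [gbS'] their difference is [N, 2L + 1]. *)
under eq_bigr => i _ do rewrite mulrBr.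
rewrite sumrB big_ord_recr [X in _ - X]big_ord_recl /=.
rewrite [qbinom L L.+1](_ : _ = 0) ?mulr0 ?addr0; last by apply: qbinom_eq0; lia.
rewrite add0r.
rewrite -sumrB; apply: eq_bigr => -[k kL] _ /=; rewrite /bump /= add1n.
have -> : k.+1%:Z - 1 = k by lia.
have -> : L.+1%:Z - 1 = L by lia.
have -> : (2 * L.+1 + M)%N%:Z - k%:Z = (2 * L + M + 1 - k).+1 by lia.
have -> : (2 * L.+1 + M)%N%:Z - k.+1%:Z = (2 * L + M + 1 - k)%N by lia.
have -> : (2 * L + M + 1 - k).+1%:Z - 1 = (2 * L + M + 1 - k)%N by lia.
have -> : 2 * L.+1%:Z - 1 = (2 * L).+1 by lia.
have -> : (2 * L.+1 = (2 * L).+2)%N by lia.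
rewrite -!/(gb _ _) gbS' mulrA; 
have -> : q ^+ (k.+1 ^ 2) * gb (2 * L + M + 1 - k) (2 * L).+2 * q ^+ (2 * (L.+1 - k.+1) + 1)
  = q ^+ (k ^ 2) * (q ^+ (2 * L).+2 * gb (2 * L + M + 1 - k) (2 * L).+2).
  by rewrite mulrAC -exprD mulrA -exprD; congr (q ^+ _ * _); nia.
rewrite -mulnn; ring.
Qed.
End QSeries.

(** * The fermionic side *)

Lemma q_neq0 : q != 0.
Proof. by rewrite /q tofrac_eq0 polyX_eq0. Qed.

Lemma qX_neq1 n : 1 - q ^+ n.+1 != 0.
Proof.
rewrite /q -tofracXn -tofrac1 -tofracB tofrac_eq0 -oppr_eq0 opprB.
by rewrite -size_poly_eq0 size_XnsubC.
Qed.

Lemma two_neq0 : 2%:R != 0 :> Kq.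
Proof. by rewrite -(tofracMn _ 1) tofrac_eq0 -polyC1 -polyCMn polyC_eq0. Qed.

Lemma qbinE : qbin = qbinom q. Proof. by []. Qed.

Lemma BBE : BB = burgeB q. Proof. by []. Qed.

Lemma qbin0 (N m : int) : ~~ ((0 <= m) && (m <= N)) -> qbin N m = 0.
Proof. by rewrite qbinE; apply: qbinom_eq0. Qed.

(* Numerator and denominator of a continued fraction; the empty one is [1/0],
   which accounts for the exceptional pairs (1,0) and (1,1) of the bars. *)
Fixpoint cfpq (s : seq nat) : nat * nat :=
  if s is x :: s' then (x * (cfpq s').1 + (cfpq s').2, (cfpq s').1)%N else (1, 0)%N.

Lemma tposS x s k : tpos (x :: s) k.+1 = (x + tpos s k)%N.
Proof. by rewrite /tpos big_ord_recl. Qed.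

Lemma ddS x s : dd (x :: s) = (x + dd s)%N.
Proof. exact: tposS. Qed.

Lemma inTE x s j : inT (x :: s) j = has (fun k => j == (x + tpos s k)%N) (iota 0 (size s).+1).
Proof.
rewrite /inT [size _]/= -[1%N]/(1 + 0)%N iotaDl has_map; apply: eq_has => k /=.
by rewrite add1n tposS.
Qed.

(** Raising the first partial quotient by 1 shifts all the t_k with k > 0 by 1. Prepending 1 does
    the same and adds the position 1, as [inT_shift1] and [inT1] record. *)
Lemma inT_shift x s j : inT (x.+1 :: s) j.+1 = inT (x :: s) j.
Proof. by rewrite !inTE; apply: eq_has => k; rewrite addSn. Qed.

Lemma inT_shift1 s j : (0 < j)%N -> inT (1%N :: s) j.+1 = inT s j.
Proof.
move=> j0; rewrite inTE /= add1n eqSS [tpos s 0](_ : _ = 0%N) ?gtn_eqF //=.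
by rewrite /tpos big_ord0.
Qed.

Lemma inT1 x s : (0 < x)%N -> inT (x :: s) 1 = (x == 1%N).
Proof.
move=> x0; rewrite inTE; apply/hasP/eqP => [[k _]|->]; first by lia.
by exists 0%N; rewrite ?mem_iota // /tpos big_ord0.
Qed.

(* [c'] is the continued fraction of the parent: [c = x.+1 :: s] and [c' = x :: s],
   or [c = 1 :: c']. *)
Section Shift.

Variables (c c' : seq nat).
Hypothesis ddc : dd c = (dd c').+1.
Hypothesis dd2 : (1 < dd c')%N.
Hypothesis inTc : forall j, (0 < j)%N -> inT c j.+1 = inT c' j.

Lemma sum_nat1S (f : nat -> int) n :
  \sum_(1 <= j < n.+2) f j = f 1%N + \sum_(1 <= j < n.+1) f j.+1.
Proof. by rewrite big_ltn // big_add1. Qed.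

Lemma sum_delta1 (f : nat -> int) n : (0 < n)%N ->
  \sum_(1 <= k < n.+1) delta 1 k * f k = f 1%N.
Proof.
case: n => // n _; rewrite sum_nat1S /delta /= mul1r big1_seq ?addr0 // => k.
by rewrite mem_index_iota => /andP[_ /andP[k0 _]]; case: k k0 => // k _; rewrite mul0r.
Qed.

(** The matrix of [c] is that of [c'] bordered by a first row and column. Only the first row, corner
    included, depends on [inT c 1]. *)
Lemma Cm_shift j k : (0 < j)%N -> (0 < k)%N -> Cm c j.+1 k.+1 = Cm c' j k.
Proof.
move=> j0 k0; rewrite /Cm /calI inTc // /delta !eqSS /= k0.
by case: k k0 => // k _; rewrite eqSS.
Qed.

Lemma Cm_col1 j : (0 < j)%N -> Cm c j.+1 1 = - delta 1 j.
Proof.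
move=> j0; rewrite /Cm /calI /delta /= !eqSS.
by case: ifP => _; case: j j0 => [//|[|j]] _.
Qed.

Lemma Cm_row1 k : (0 < k)%N -> Cm c 1 k.+1 = (-1) ^+ (~~ inT c 1) * delta 1 k.
Proof.
move=> k0; rewrite /Cm /calI /delta /=.
by case: ifP => _; case: k k0 => [//|[|k]] _.
Qed.

Lemma Cm11 : Cm c 1 1 = 1 + (~~ inT c 1)%:R.
Proof. by rewrite /Cm /calI /delta /=; case: ifP. Qed.

Lemma mc1 i m : mc (i :: m) 1 = i%:Z.
Proof. by []. Qed.

Lemma mcS i m j : (0 < j)%N -> mc (i :: m) j.+1 = mc m j.
Proof. by case: j. Qed.

Lemma nvec1 L i m : nvec c L (i :: m) 1 =
  L%:Z - (if inT c 1 then i%:Z + mc m 1 else 2 * i%:Z - mc m 1).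
Proof.
rewrite /nvec ddc sum_nat1S.
rewrite (eq_big_nat _ _ (F2 := fun k => delta 1 k * ((-1) ^+ (~~ inT c 1) * mc m k))).
  rewrite sum_delta1 ?(ltnW dd2) // Cm11 mc1 {1}/delta /= mulr1.
  by case: inT; rewrite /= ?expr0 ?expr1; ring.
by move=> k /andP[k0 _]; rewrite Cm_row1 // mcS //; ring.
Qed.

(** The entry -1 in the first column puts the new variable i where n_1 of the parent has L, so the
    parent reappears with L replaced by i. *)
Lemma nvecS L i m j : (0 < j)%N -> nvec c L (i :: m) j.+1 = nvec c' i m j.
Proof.
move=> j0; rewrite /nvec ddc sum_nat1S Cm_col1 //.
rewrite {1}/delta eqSS (gtn_eqF j0) mulr0 sub0r opprD mulNr opprK.
congr (_ - _); first by rewrite mulrC /delta eq_sym.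
by apply: eq_big_nat => k /andP[k0 _]; rewrite Cm_shift // mcS.
Qed.

(** The border row and column each contribute i m_1 up to sign, m_1 being the first variable of the
    parent. They cancel if [inT c 1] and add up to -2 i m_1 otherwise. *)
Lemma quadC_shift (i : nat) m : quadC c (i :: m) =
  quadC c' m + (if inT c 1 then i%:Z * i%:Z else 2 * (i%:Z * i%:Z) - 2 * i%:Z * mc m 1).
Proof.
have d0 : (0 < dd c')%N by exact: ltnW.
rewrite /quadC ddc sum_nat1S sum_nat1S.
rewrite (eq_big_nat _ _ (F2 := fun k =>
  delta 1 k * (i%:Z * ((-1) ^+ (~~ inT c 1) * mc m k)))); last first.
  by move=> k /andP[k0 _]; rewrite mc1 Cm_row1 // mcS //; ring.
rewrite sum_delta1 //.
rewrite [X in _ + X = _](eq_big_nat _ _ (F2 := fun j => delta 1 j * (- i%:Z * mc m j) +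
   \sum_(1 <= k < (dd c').+1) mc m j * Cm c' j k * mc m k)); last first.
  move=> j /andP[j0 _]; rewrite sum_nat1S mcS // Cm_col1 //; congr (_ + _).
    by rewrite mc1; ring.
  by apply: eq_big_nat => k /andP[k0 _]; rewrite Cm_shift // mcS.
rewrite big_split /= sum_delta1 // Cm11 mc1.
by case: inT; rewrite /= ?expr0 ?expr1; ring.
Qed.

Lemma Am_shift i m : Am c (i :: m) = Am c' m.
Proof.
rewrite /Am ddc; have : (0 < (dd c').-1)%N by lia.
by case: (dd c') => [|[|n]] // _.
Qed.

Lemma prodbin_shift L i m : prodbin c L (i :: m) =
  qbin (L%:Z + (if inT c 1 then i%:Z - mc m 1 else mc m 1)) (2 * i%:Z) * prodbin c' i m.
Proof.
have d0 : (0 < dd c')%N by exact: ltnW.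
rewrite /prodbin ddc big_ltn // big_add1 /=; congr (_ * _).
  (* As [dd c'] > 1, the corrections at the indices d and d - 1 do not reach the new first
     factor. *)
  rewrite nvec1 /tau ddc ltnS d0 /delta eqSS (ltn_eqF d0) (ltn_eqF dd2) mc1 /=.
  by congr qbin; [case: inT; ring | ring].
apply: eq_big_nat => j /andP[j0 _].
rewrite mcS // nvecS // /tau ddc ltnS /delta eqSS.
by have -> : (j.+1 == dd c') = (j == (dd c').-1) by case: (dd c') dd2.
Qed.

End Shift.

(** * Finitely supported sums over vectors *)

Definition wsum (d : nat) (f : seq nat -> Kq) : Kq :=
  \sum_(m \in [set m : seq nat | size m = d]%classic) f m.

Lemma eq_wsum d f g : (forall m, size m = d -> f m = g m) -> wsum d f = wsum d g.
Proof. by move=> fg; apply: eq_fsbigr => m; rewrite inE => /fg. Qed.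

Lemma wsum0 f : wsum 0 f = f [::].
Proof.
rewrite /wsum (_ : [set m | size m = 0%N]%classic = [set [::]]%classic) ?fsbig_set1 //.
by apply/seteqP; split => [[]|? ->].
Qed.

Fixpoint seqs_over (r : seq nat) (d : nat) : seq (seq nat) :=
  if d is d'.+1 then [seq i :: m | i <- r, m <- seqs_over r d'] else [:: [::]].

Lemma mem_seqs_over r d m : (m \in seqs_over r d) = (size m == d) && all (mem r) m.
Proof.
elim: d m => [|d IH] [|i m] //=.
  by apply/allpairsP => -[[j p] /= []].
rewrite eqSS; apply/allpairsP/idP => [[[j p] /= [jB pd [-> ->]]]|].
  by move: pd; rewrite IH jB.
by move=> /and3P[md iB mB]; exists (i, m); split => //=; rewrite IH md.
Qed.

Lemma seqs_over_uniq r d : uniq r -> uniq (seqs_over r d).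
Proof.
move=> ur; elim: d => [//|d IH]; apply: allpairs_uniq => //.
by move=> [i m] [j p] _ _ /= [-> ->].
Qed.

Lemma wsumE B d f : (forall m, size m = d -> f m != 0 -> all (fun i => i <= B)%N m) ->
  wsum d f = \sum_(m <- seqs_over (iota 0 B.+1) d) f m.
Proof.
move=> fB; rewrite (fsbig_seq _ _ (seqs_over_uniq d (iota_uniq 0 B.+1))).
apply/esym/fsbig_widen => m /=; first by rewrite mem_seqs_over => /andP[/eqP].
move=> [md /negP]; rewrite mem_seqs_over md eqxx andTb.
apply: contraNeq => /(fB _ md); apply: sub_all => i iB.
by change (i \in iota 0 B.+1); rewrite mem_iota ltnS.
Qed.

Lemma wsumS B d f : (forall m, size m = d.+1 -> f m != 0 -> all (fun i => i <= B)%N m) ->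
  wsum d.+1 f = \sum_(i < B.+1) wsum d (fun m => f ((i : nat) :: m)).
Proof.
move=> fB; rewrite (wsumE fB) [seqs_over _ _.+1]/(allpairs_dep _ _ _) big_allpairs_dep.
rewrite -[iota 0 B.+1]/(index_iota 0 B.+1) big_mkord; apply: eq_bigr => i _.
rewrite (@wsumE B) // => m md /fB /= md'.
by have /andP[] := md' (congr1 S md).
Qed.

(** * Induction on continued fractions and the support of the fermionic product *)

Definition valid_cf (c : seq nat) := [&& c != [::], all (leq 1) c & (1 < last 0 c)%N].

(** Induction on [dd c]: a first entry above 1 is lowered by 1, a first entry 1 is removed. As the
    last entry is at least 2, the result stays valid until [2] is reached. Only the sequence [1] of
    the pair (2,1) is left aside. *)
Lemma valid_cf_ind (P : seq nat -> Prop) :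
  P [:: 2%N] ->
  (forall x s, (0 < x)%N -> valid_cf (x :: s) -> P (x :: s) -> P (x.+1 :: s)) ->
  (forall s, valid_cf s -> P s -> P (1%N :: s)) ->
  forall c, valid_cf c -> P c.
Proof.
move=> P2 PS P1 c; have [n] := ubnP (dd c); elim: n c => // n IH [|[|[|x]] s] //.
  rewrite ddS ltnS => ds /and3P[_ /= a l].
  have s0 : s != [::] by case: s l {ds a}.
  have vs : valid_cf s by rewrite /valid_cf s0 a; case: s l s0 {ds a}.
  by apply: P1 => //; apply: IH.
rewrite ddS ltnS => ds /and3P[_ /= a l].
have [E|E] := eqVneq (x.+2 :: s) [:: 2%N]; first by rewrite E.
have vs : valid_cf (x.+1 :: s).
  by rewrite /valid_cf /= a; case: s E l {ds a} => //= ; case: x.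
by apply: PS => //; apply: IH => //; rewrite ddS; lia.
Qed.

Lemma valid_cf_dd c : valid_cf c -> (1 < dd c)%N.
Proof.
elim/valid_cf_ind; last by move=> s _; rewrite ddS; lia.
  by rewrite /dd /tpos /= !big_ord_recl big_ord0.
by move=> x s _ _; rewrite !ddS; lia.
Qed.

Lemma dd_two : dd [:: 2%N] = 2%N.
Proof. by rewrite /dd /tpos big_ord1. Qed.

Lemma Cm2 j k : Cm [:: 2%N] j k = 2 * delta j k -
  (if j == 2%N then delta j k.+1 + delta j k - delta j k.-1 * (0 < k)%:R
   else delta j k.+1 + delta j k.-1 * (0 < k)%:R).
Proof. by rewrite /Cm /calI /inT /= orbF /tpos big_ord1. Qed.

Lemma quadC2 m1 m2 : quadC [:: 2%N] [:: m1; m2] =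
  2 * (m1%:Z * m1%:Z) - 2 * (m1%:Z * m2%:Z) + m2%:Z * m2%:Z.
Proof.
by rewrite /quadC dd_two unlock /= !Cm2 /delta /mc /=; ring.
Qed.

Lemma prodbin2 L m1 m2 : prodbin [:: 2%N] L [:: m1; m2] =
  qbin (L%:Z + m2%:Z) (2 * m1%:Z - 1) * qbin (m1%:Z - 1) m2%:Z.
Proof.
have nv1 : nvec [:: 2%N] L [:: m1; m2] 1 = L%:Z - 2 * m1%:Z + m2%:Z.
  by rewrite /nvec dd_two unlock /= !Cm2 /delta /mc /=; ring.
have nv2 : nvec [:: 2%N] L [:: m1; m2] 2 = m1%:Z - m2%:Z.
  by rewrite /nvec dd_two unlock /= !Cm2 /delta /mc /=; ring.
rewrite /prodbin dd_two big_ltn // big_ltn // big_geq // mulr1 nv1 nv2 /tau dd_two /delta /mc /=.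
by congr (qbin _ _ * qbin _ _); ring.
Qed.

Lemma Am2 m1 m2 : Am [:: 2%N] [:: m1; m2] = 2 * m2%:Z - 2 * m1%:Z + 1.
Proof. by rewrite /Am dd_two. Qed.

(** Makes the fermionic sums finite. The parent's product, taken at i = m_1, bounds the remaining
    entries by i; the first q-binomial then yields i <= L. *)
Lemma prodbin_supp c : valid_cf c -> forall L m, size m = dd c ->
  prodbin c L m != 0 -> all (fun i => i <= L)%N m.
Proof.
have sub L i m : (i <= L)%N -> all (fun j => j <= i)%N m -> all (fun j => j <= L)%N (i :: m).
  by move=> iL /= mi; rewrite iL; apply: sub_all mi => j; move/leq_trans; apply.
have nz (N m : int) (x : Kq) : qbin N m * x != 0 -> (0 <= m) && (m <= N).
  by apply: contraR => /qbin0 ->; rewrite mul0r.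
elim/valid_cf_ind => [L|x s x0 vs IH L|s vs IH L].
- rewrite dd_two => -[|m1 [|m2 []]] // _; rewrite prodbin2 => H.
  have := nz _ _ _ H; move: H; rewrite mulrC => /nz H H'; rewrite /=; lia.
- move=> [|i [|j m]]; rewrite ddS //=; first by have := valid_cf_dd vs; rewrite ddS; lia.
  move=> [sm]; rewrite (@prodbin_shift _ (x :: s)) ?ddS ?inT1 ?eqSS //; last 2 first.
  + by have := valid_cf_dd vs; rewrite ddS.
  + by move=> k _; exact: inT_shift.
  rewrite (gtn_eqF x0) => H.
  have := nz _ _ _ H; move: H; rewrite mulf_eq0 negb_or => /andP[_ /IH].
  rewrite /= ddS => /(_ sm) /= ij H.
  apply: (sub L i (j :: m)) => //=.
  by move: ij H => /andP[ji _]; rewrite /mc /=; lia.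
- move=> [|i [|j m]]; rewrite ddS //=; first by have := valid_cf_dd vs; lia.
  move=> [sm]; rewrite (@prodbin_shift _ s) ?ddS ?inT1 //; last 2 first.
  + exact: valid_cf_dd.
  + by move=> k; exact: inT_shift1.
  move=> H.
  have := nz _ _ _ H; move: H; rewrite mulf_eq0 negb_or => /andP[_ /IH] /(_ sm) /= ij H.
  apply: (sub L i (j :: m)) => //=.
  by move: ij H => /andP[ji _]; rewrite /mc /=; lia.
Qed.

(* The common part of both forms of [H]: the sum over all variables but [m_1 = i].
   By [core_cfgsum] it is the bosonic sum of the parent pair at [(i, L-i)]. *)
Definition core (c : seq nat) (L i : nat) : Kq :=
  wsum (dd c).-1 (fun m => q ^ (quadC c (i :: m) + Am c (i :: m) - i%:Z * i%:Z)
    * prodbin c L (i :: m)).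

Definition Hlt (c : seq nat) (L M : nat) : Kq :=
  wsum (dd c) (fun m => q ^ (quadC c m + Am c m)
        * qbin (2 * L%:Z + M%:Z - mc m 1) (2 * L%:Z) * prodbin c L m).

Definition Hgt (c : seq nat) (L M : nat) : Kq :=
  wsum (dd c) (fun m => q ^ (L%:Z * (L%:Z - 2 * mc m 1) + quadC c m + Am c m)
        * qbin (L%:Z + M%:Z + mc m 1) (2 * L%:Z) * prodbin c L m).

(** The sum over m_1 = i is split off, and the i^2 removed in [core] returns as q^(i^2). In
    [Hgt_core] it completes L(L - 2i) to (L - i)^2. *)
Lemma Hlt_core c L M : valid_cf c ->
  Hlt c L M = \sum_(i < L.+1) q ^+ (i ^ 2) * qbin ((2 * L + M)%N%:Z - i%:Z) (2 * L)%N * core c L i.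
Proof.
move=> vc; have d1 := valid_cf_dd vc; rewrite /Hlt /core.
case E : (dd c) d1 => [//|d] _; rewrite (@wsumS L); last first.
  by move=> m md; rewrite mulf_eq0 negb_or => /andP[_]; apply: prodbin_supp; rewrite ?E.
apply: eq_bigr => i _; rewrite /wsum mulr_fsumr; apply: eq_fsbigr => m _.
rewrite mc1 [RHS]mulrA; congr (_ * _); rewrite [RHS]mulrAC; congr (_ * _).
rewrite exprnP -expfzDr ?q_neq0 //; congr (q ^ _); lia.
Qed.

Lemma Hgt_core c L M : valid_cf c ->
  Hgt c L M =
  \sum_(i < L.+1) q ^+ ((L - i) ^ 2) * qbin ((L + M)%N%:Z + i%:Z) (2 * L)%N * core c L i.
Proof.
move=> vc; have d1 := valid_cf_dd vc; rewrite /Hgt /core.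
case E : (dd c) d1 => [//|d] _; rewrite (@wsumS L); last first.
  by move=> m md; rewrite mulf_eq0 negb_or => /andP[_]; apply: prodbin_supp; rewrite ?E.
apply: eq_bigr => i _; rewrite /wsum mulr_fsumr; apply: eq_fsbigr => m _.
rewrite mc1 [RHS]mulrA; congr (_ * _); rewrite [RHS]mulrAC; congr (_ * _).
rewrite exprnP -expfzDr ?q_neq0 //; congr (q ^ _).
by case: i => i /= iL; nia.
Qed.

(** Without i^2, the new part of the exponent is i(i - 2m_1) here and 0 in [core_one], with m_1 the
    parent's first variable. The first q-binomials [L + m_1, 2i] and [L + i - m_1, 2i] are those of
    [Hgt] and [Hlt] at (i, L - i). *)
Lemma core_succ x s L i : (0 < x)%N -> valid_cf (x :: s) -> (i <= L)%N ->
  core (x.+1 :: s) L i = Hgt (x :: s) i (L - i).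
Proof.
move=> x0 vs iL; have d1 := valid_cf_dd vs.
have ddE : dd (x.+1 :: s) = (dd (x :: s)).+1 by rewrite !ddS.
have TE j : (0 < j)%N -> inT (x.+1 :: s) j.+1 = inT (x :: s) j by move=> _; exact: inT_shift.
rewrite /core /Hgt ddE; apply: eq_wsum => m md.
rewrite (prodbin_shift ddE) // (quadC_shift ddE) // (Am_shift ddE) // inT1 // eqSS (gtn_eqF x0).
rewrite [LHS]mulrA; congr (_ * _ * _); [congr (q ^ _) | congr qbin]; lia.
Qed.

Lemma core_one s L i : valid_cf s -> (i <= L)%N ->
  core (1%N :: s) L i = Hlt s i (L - i).
Proof.
move=> vs iL; have d1 := valid_cf_dd vs.
have ddE : dd (1%N :: s) = (dd s).+1 by rewrite !ddS.
have TE j : (0 < j)%N -> inT (1%N :: s) j.+1 = inT s j by exact: inT_shift1.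
rewrite /core /Hlt ddE; apply: eq_wsum => m md.
rewrite (prodbin_shift ddE) // (quadC_shift ddE) // (Am_shift ddE) // inT1 // eqxx.
rewrite [LHS]mulrA; congr (_ * _ * _); [congr (q ^ _) | congr qbin]; lia.
Qed.

Lemma core2 L i : (i <= L)%N -> core [:: 2%N] L i = gsum q 0 2 1 1 0 i (L - i).
Proof.
move=> iL; rewrite (gsum21 q_neq0 qX_neq1 two_neq0) /core dd_two /=.
rewrite (@wsumS i) => [|[|m [|m']] // _]; last first.
  rewrite prodbin2 !mulf_eq0 !negb_or /= andbT => /and3P[_ _].
  by apply: contraR => H; apply/eqP/qbin0; lia.
rewrite big_ord_recr /= wsum0 prodbin2 [qbin (_ - 1) i]qbin0 ?mulr0 ?addr0; last by lia.
(* The remaining exponent is (i - 1 - m_2)^2, so k = i - 1 - m_2 gives the summand of [gsum21]. *)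
rewrite (reindex_inj rev_ord_inj) /=; apply: eq_bigr => k _; rewrite wsum0 quadC2 Am2 prodbin2.
case: k => k /= ki; rewrite [LHS]mulrA; congr (_ * _ * _).
- by rewrite exprnP; congr (q ^ _); nia.
- by rewrite qbinE; congr qbinom; lia.
- by rewrite qbinE -qbinom_sym; congr qbinom; lia.
Qed.

(** * Continued fractions and the induction *)

(** Dropping the last partial quotient gives the convergent behind the bars; at order 0 it is the
    empty fraction 1/0. *)
Definition cfinit (c : seq nat) := take (cforder c) c.

Lemma cfpq_cons x s : cfpq (x :: s) = ((x * (cfpq s).1 + (cfpq s).2)%N, (cfpq s).1).
Proof. by []. Qed.

Lemma cfpq_gt0 c : all (leq 1) c -> (0 < (cfpq c).1)%N.
Proof. by elim: c => //= x s IH /andP[x0 /IH p0]; rewrite addn_gt0 muln_gt0 x0 p0. Qed.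

Lemma cfinit_cons x y s : cfinit (x :: y :: s) = x :: cfinit (y :: s).
Proof. by []. Qed.

Lemma cfpq_init c : c != [::] -> all (leq 1) c ->
  ((cfpq (cfinit c)).1 <= (cfpq c).1)%N && ((cfpq (cfinit c)).2 <= (cfpq c).2)%N.
Proof.
elim: c => // x [|y s] IH _; first by rewrite /= muln1 addn0 !andbT.
move=> /andP[x0 a]; have /andP[h1 h2] := IH isT a.
rewrite cfinit_cons [cfpq (x :: cfinit _)]/= [cfpq (x :: y :: s)]/= h1 andbT.
by rewrite leq_add // leq_mul2l h1 orbT.
Qed.

Lemma cfpq_coprime c : coprime (cfpq c).1 (cfpq c).2.
Proof.
elim: c => // x s IH /=; by rewrite /coprime gcdnC gcdnMDl.
Qed.

Lemma cfval_cfpq c : c != [::] -> all (leq 1) c ->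
  cfval c = (cfpq c).1%:R / (cfpq c).2%:R.
Proof.
elim: c => // x [|y s] IH _; first by rewrite /= muln1 addn0 divr1.
move=> /andP[x0 a]; have p0 := @cfpq_gt0 (y :: s) a.
rewrite [cfval _]/((x%:R + (cfval (y :: s))^-1)%R) IH // (cfpq_cons x).
move: (cfpq (y :: s)) p0 => [p r] /= p0.
by rewrite invf_div natrD natrM mulrDl mulfK // pnatr_eq0 -lt0n.
Qed.

(** With P/Q the value and P'/Q' the convergent, this is P'Q or PQ'. Passing to (P + Q, P) adds PP'
    and exchanges the kinds a'b and ab'; passing to (P + Q, Q) adds QQ' and preserves them. Hence
    the parity pattern of (i) and (ii). *)
Definition cfkind (c : seq nat) : int :=
  if odd (cforder c) then (cfpq (cfinit c)).1%:Z * (cfpq c).2%:Z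
  else (cfpq c).1%:Z * (cfpq (cfinit c)).2%:Z.

Definition cfgsum (c : seq nat) (L M : nat) : Kq :=
  gsum q (cfkind c) (cfpq c).1 (cfpq c).2 (cfpq (cfinit c)).1 (cfpq (cfinit c)).2 L M.

Lemma valid_cf_pos c : valid_cf c -> (0 < (cfpq c).1)%N && (0 < (cfpq c).2)%N.
Proof.
case: c => // x s /and3P[_ a _]; rewrite (cfpq_gt0 a) /=.
by apply: cfpq_gt0; case/andP: a.
Qed.

(** Since 0 <= P' <= P and 0 <= Q' <= Q, both factors are nonnegative for j >= 0 and nonpositive for
    j < 0. This is the sign condition of the Burge transform. *)
Lemma cfpq_sign c : valid_cf c -> forall j : int,
  0 <= ((cfpq c).1%:Z * j + (cfpq (cfinit c)).1%:Z) * ((cfpq c).2%:Z * j + (cfpq (cfinit c)).2%:Z).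
Proof.
move=> /and3P[c0 a _] j; have := cfpq_init c0 a.
move: (cfpq _) (cfpq _) => [P Q] [P' Q'] /= /andP[h1 h2].
case: j => j; first by apply: mulr_ge0; nia.
by rewrite NegzE; apply: mulr_le0; nia.
Qed.

(** The evaluation of [core] is a hypothesis so that the lemma serves both inside the induction
    proving it and in the final step. *)
Lemma gsum_Hlt c : valid_cf c -> (forall L i, (i <= L)%N -> core c L i = cfgsum c i (L - i)) ->
  forall L M, gsum q (cfkind c + (cfpq c).1%:Z * (cfpq (cfinit c)).1%:Z)
    ((cfpq c).1%:Z + (cfpq c).2%:Z) (cfpq c).1
    ((cfpq (cfinit c)).1%:Z + (cfpq (cfinit c)).2%:Z) (cfpq (cfinit c)).1 L M = Hlt c L M.
Proof.
move=> vc H L M; have /andP[P0 Q0] := valid_cf_pos vc.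
rewrite (gsum_burge_swap q_neq0 qX_neq1) //; last exact: cfpq_sign.
rewrite Hlt_core //; apply: eq_bigr => i _; rewrite H //.
by rewrite -ltnS.
Qed.

Lemma gsum_Hgt c : valid_cf c -> (forall L i, (i <= L)%N -> core c L i = cfgsum c i (L - i)) ->
  forall L M, gsum q (cfkind c + (cfpq c).2%:Z * (cfpq (cfinit c)).2%:Z)
    ((cfpq c).1%:Z + (cfpq c).2%:Z) (cfpq c).2
    ((cfpq (cfinit c)).1%:Z + (cfpq (cfinit c)).2%:Z) (cfpq (cfinit c)).2 L M = Hgt c L M.
Proof.
move=> vc H L M; have /andP[P0 Q0] := valid_cf_pos vc.
(* The Burge index is L - m_1 here, hence the reversal of the sum. *)
rewrite (gsum_burge q_neq0 qX_neq1) //; last exact: cfpq_sign.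
rewrite Hgt_core // (reindex_inj rev_ord_inj) /=; apply: eq_bigr => -[i iL] _ /=.
rewrite subSS H // subKn // qbinE; congr (_ * _ * _).
by congr (qbinom _ _ _); lia.
Qed.

Lemma eq_gsum (c a b a' b' c1 a1 b1 a1' b1' : int) L M :
  c = c1 -> a = a1 -> b = b1 -> a' = a1' -> b' = b1' ->
  gsum q c a b a' b' L M = gsum q c1 a1 b1 a1' b1' L M.
Proof. by move=> -> -> -> -> ->. Qed.

Lemma cforder_cons x y s : cforder (x :: y :: s) = (cforder (y :: s)).+1.
Proof. by []. Qed.

Lemma core_cfgsum c : valid_cf c -> forall L i, (i <= L)%N -> core c L i = cfgsum c i (L - i).
Proof.
elim/valid_cf_ind => [L i iL|x s x0 vs IH L i iL|s vs IH L i iL].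
- by rewrite core2.
- rewrite core_succ // -gsum_Hgt // /cfgsum /cfkind.
  case: s {vs IH} => [|y s].
    by apply: eq_gsum; rewrite /= ?muln1 ?addn0 //; lia.
  rewrite !cfinit_cons !cforder_cons !(cfpq_cons x) !(cfpq_cons x.+1) oddS.
  move: (odd _) (cfpq (y :: s)) (cfpq (cfinit (y :: s))) => o [P Q] [P' Q'].
  by apply: eq_gsum; case: o => /=; lia.
- rewrite core_one // -gsum_Hlt // /cfgsum /cfkind; case: s {IH} vs => // y s _.
  rewrite !cfinit_cons !cforder_cons !(cfpq_cons 1) oddS.
  move: (odd _) (cfpq (y :: s)) (cfpq (cfinit (y :: s))) => o [P Q] [P' Q'].
  by apply: eq_gsum; case: o => /=; lia.
Qed.

(** * From the continued fraction data to the statement *)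

Lemma numdenq_nat (p r : nat) : coprime p r -> (0 < r)%N ->
  numq (p%:R / r%:R) = p /\ denq (p%:R / r%:R) = r.
Proof.
move=> pr r0; split.
  by rewrite -[p%:R]/(p%:Z%:~R) -[r%:R]/(r%:Z%:~R) coprimeq_num // gtr0_sg ?mul1r.
by rewrite -[p%:R]/(p%:Z%:~R) -[r%:R]/(r%:Z%:~R) coprimeq_den // gt_eqF.
Qed.

Lemma tri_double (j t : int) : ((j * (j + 1) + 2 * t) %/ 2)%Z = tri j + t.
Proof. by rewrite -tri2 -mulrDr mulKz. Qed.

Lemma LHSsum_gsum (expo : int -> int) a b cfs (c : int) L M :
  (forall j, expo j = ((j * ((2 * a%:Z * b%:Z + 1) * j + 4 * c + 1)) %/ 2)%Z
     + abar a b cfs * bbar a b cfs) ->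
  LHSsum expo a b cfs L M = gsum q c a b (abar a b cfs) (bbar a b cfs) L M.
Proof.
move=> e; apply: eq_fsbigr => j _; rewrite BBE e; congr (_ * q ^ _ * _).
have -> : j * ((2 * a%:Z * b%:Z + 1) * j + 4 * c + 1) =
   j * (j + 1) + 2 * (a%:Z * b%:Z * (j * j) + 2 * c * j) by ring.
by rewrite tri_double !addrA.
Qed.

Lemma LHSsum_expo1 a b cfs L M : LHSsum (expo1 a b cfs) a b cfs L M =
  gsum q (abar a b cfs * b%:Z) a b (abar a b cfs) (bbar a b cfs) L M.
Proof. by apply: LHSsum_gsum => j; rewrite /expo1 -[4 * _ * _]mulrA. Qed.

Lemma LHSsum_expo2 a b cfs L M : LHSsum (expo2 a b cfs) a b cfs L M =
  gsum q (a%:Z * bbar a b cfs) a b (abar a b cfs) (bbar a b cfs) L M.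
Proof. by apply: LHSsum_gsum => j; rewrite /expo2 -[4 * _ * _]mulrA. Qed.

Lemma H21E L M : H21 L M = gsum q 0 2 1 1 0 L M.
Proof.
rewrite (gsum21 q_neq0 qX_neq1 two_neq0).
rewrite (fsbig_ord +%R L (fun k =>
  q ^+ (k * k) * qbinom q (2 * L%:Z + M%:Z - k%:Z - 1) (2 * L%:Z - 1) * qbinom q (L%:Z - 1) k%:Z)).
apply/esym/fsbig_widen => // k [_ /= /negP]; rewrite -leqNgt => Lk.
by rewrite [X in _ * X]qbinom_eq0 ?mulr0 //; lia.
Qed.

Lemma coprime_frac_inj (x y p r : nat) : coprime x y -> coprime p r ->
  (0 < y)%N -> (0 < r)%N -> x%:R / y%:R = p%:R / r%:R :> rat -> x = p /\ y = r.
Proof.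
move=> xy pr y0 r0 e.
have [nx dy] := numdenq_nat xy y0; have [np dr] := numdenq_nat pr r0.
by split; apply/eqP; rewrite -eqz_nat -?nx -?dy e ?np ?dr.
Qed.

Lemma valid_cf_neq0 c : valid_cf c -> c != [::] /\ all (leq 1) c.
Proof. by case/and3P. Qed.

Lemma coprime_subl a b : (b <= a)%N -> coprime (a - b) b = coprime a b.
Proof. by move=> ba; rewrite /coprime !(gcdnC _ b) -{2}(subnK ba) gcdnDr. Qed.

(** Here the fraction is b/(a - b), and in [cfpq_gt] it is (a - b)/b; both are in lowest terms, as
    is P/Q. *)
Lemma cfpq_lt c a b : valid_cf c -> coprime a b -> (0 < b)%N -> (b < a)%N -> (a < 2 * b)%N ->
  cfval c = cfx a b -> a = ((cfpq c).1 + (cfpq c).2)%N /\ b = (cfpq c).1.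
Proof.
move=> vc ab b0 ba a2b; have [c0 pc] := valid_cf_neq0 vc; have /andP[P0 Q0] := valid_cf_pos vc.
rewrite cfval_cfpq // /cfx a2b ltnNge (ltnW a2b) /= => e.
have cop : coprime b (a - b) by rewrite coprime_sym coprime_subl ?(ltnW ba).
have ab0 : (0 < a - b)%N by rewrite subn_gt0.
have b0' : (b%:R != 0 :> rat) by rewrite pnatr_eq0 -lt0n.
have [|E1 E2] := coprime_frac_inj cop (cfpq_coprime c) ab0 Q0; last by lia.
by rewrite e natrB ?(ltnW ba) // -invf_div mulrBl divff.
Qed.

Lemma cfpq_gt c a b : valid_cf c -> coprime a b -> (0 < b)%N -> (2 * b < a)%N ->
  cfval c = cfx a b -> a = ((cfpq c).1 + (cfpq c).2)%N /\ b = (cfpq c).2.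
Proof.
move=> vc ab b0 a2b; have [c0 pc] := valid_cf_neq0 vc; have /andP[P0 Q0] := valid_cf_pos vc.
have ba : (b < a)%N by lia.
rewrite cfval_cfpq // /cfx a2b /= => e.
have cop : coprime (a - b) b by rewrite coprime_subl ?(ltnW ba).
have b0' : (b%:R != 0 :> rat) by rewrite pnatr_eq0 -lt0n.
have [|E1 E2] := coprime_frac_inj cop (cfpq_coprime c) b0 Q0; last by lia.
by rewrite e natrB ?(ltnW ba) // mulrBl divff.
Qed.

Lemma cfpq_gt1 c : valid_cf c -> (1 < (cfpq c).1)%N.
Proof.
elim/valid_cf_ind => // [x s x0 vs IH|s vs IH]; have /andP[] := valid_cf_pos vs;
  rewrite ?cfpq_cons /=; lia.
Qed.

Lemma valid_cf_cases c : valid_cf c ->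
  (exists2 x, c = [:: x] & (1 < x)%N) \/
  (exists x s, [/\ c = x :: s, (0 < x)%N, valid_cf s & cfinit c = x :: cfinit s]).
Proof.
case: c => [//|x [|y s]] /and3P[_ a l]; first by left; exists x.
right; exists x, (y :: s); case/andP: a => x0 a; split=> //.
by apply/and3P; split.
Qed.

Lemma cfinit_pos c : all (leq 1) c -> all (leq 1) (cfinit c).
Proof. by rewrite -{1}(cat_take_drop (cforder c) c) all_cat => /andP[]. Qed.

(** A single partial quotient means Q = 1, that is b = a - 1, where 1/0 gives the bars (1,1).
    Otherwise the bars form the reduced fraction 1 + Q'/P'. *)
Lemma bars_lt c a b : valid_cf c -> (a < 2 * b)%N ->
  a = ((cfpq c).1 + (cfpq c).2)%N -> b = (cfpq c).1 ->
  abar a b c = ((cfpq (cfinit c)).1 + (cfpq (cfinit c)).2)%N /\ bbar a b c = (cfpq (cfinit c)).1.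
Proof.
move=> vc a2b ea eb; have := cfpq_gt1 vc; rewrite -eb => b1.
rewrite /abar /bbar (gtn_eqF b1).
case: (valid_cf_cases vc) => [[x cx x1]|[x [s [cx x0 vs ci]]]].
  have -> : (b == a.-1) && (2 < a)%N by rewrite ea eb cx /=; lia.
  by rewrite cx.
have Q1 : (1 < (cfpq c).2)%N by rewrite cx; exact: cfpq_gt1.
have -> : (b == a.-1) = false by lia.
rewrite /= /barval a2b cfval_cfpq //; last first.
  by apply: cfinit_pos; case/and3P: vc.
have -> : ((cfpq (cfinit c)).1 + (cfpq (cfinit c)).2)%N = (cfpq (1%N :: cfinit c)).1.
  by rewrite cfpq_cons mul1n.
have p1 : (0 < (cfpq (cfinit c)).1)%N by apply: cfpq_gt0; apply: cfinit_pos; case/and3P: vc.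
exact: numdenq_nat (cfpq_coprime (1%N :: cfinit c)) p1.
Qed.

(** A single partial quotient means b = 1, where 1/0 gives the bars (1,0). Otherwise the bars form
    the reduced fraction 1 + P'/Q'. *)
Lemma bars_gt c a b : valid_cf c -> (2 * b < a)%N ->
  a = ((cfpq c).1 + (cfpq c).2)%N -> b = (cfpq c).2 ->
  abar a b c = ((cfpq (cfinit c)).1 + (cfpq (cfinit c)).2)%N /\ bbar a b c = (cfpq (cfinit c)).2.
Proof.
move=> vc a2b ea eb; have P1 := cfpq_gt1 vc.
rewrite /abar /bbar.
case: (valid_cf_cases vc) => [[x cx x1]|[x [s [cx x0 vs ci]]]].
  by rewrite eb cx.
have b1 : (1 < b)%N by rewrite eb cx; exact: cfpq_gt1.
rewrite (gtn_eqF b1); have -> : (b == a.-1) = false by lia.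
have ps : all (leq 1) (cfinit s) by apply: cfinit_pos; case/and3P: vs.
have -> : barval a b c = cfval (x.+1 :: cfinit s) by rewrite /barval ltnNge (ltnW a2b) cx.
rewrite andFb cfval_cfpq // ci.
have -> : ((cfpq (x :: cfinit s)).1 + (cfpq (x :: cfinit s)).2)%N = (cfpq (x.+1 :: cfinit s)).1.
  by rewrite !cfpq_cons /=; lia.
exact: numdenq_nat (cfpq_coprime (x.+1 :: cfinit s)) (cfpq_gt0 ps).
Qed.

Theorem theorem5p2 (L M a b : nat) (cfs : seq nat) :
  coprime a b -> (1 <= b)%N -> (b < a)%N -> is_cf a b cfs ->
  ((((a < 2 * b)%N && ~~ odd (cforder cfs)) || ((2 * b < a)%N && odd (cforder cfs))) ->
     LHSsum (expo1 a b cfs) a b cfs L M = Hab a b cfs L M) /\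
  ((((a < 2 * b)%N && odd (cforder cfs)) || ((2 * b <= a)%N && ~~ odd (cforder cfs))) ->
     LHSsum (expo2 a b cfs) a b cfs L M = Hab a b cfs L M).
Proof.
move=> cab b0 ba [c0 pc vc lc].
case: (ltngtP a (2 * b)%N) => a2b; last first.
(* By coprimality, a = 2b leaves only the pair (2,1), of order 0. *)
- have b1 : b = 1%N.
    by move: cab; rewrite a2b /coprime gcdnC gcdnMl => /eqP.
  rewrite a2b b1 /= in lc *; rewrite lc; split => // _.
  by rewrite LHSsum_expo2 /Hab /= H21E.
- have v : valid_cf cfs.
    move: lc; rewrite (_ : (a == 2%N) && (b == 1%N) = false) => [l|]; last by lia.
    by rewrite /valid_cf c0 pc.
  have [ea eb] := cfpq_gt v cab b0 a2b vc.
  have [ab bb] := bars_gt v a2b ea eb.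
  rewrite LHSsum_expo1 LHSsum_expo2 ab bb.
  have -> : Hab a b cfs L M = Hgt cfs L M.
    by rewrite /Hab ltnNge (ltnW a2b) /= ifF //; lia.
  rewrite -gsum_Hgt //; last exact: core_cfgsum.
  (* The parity of the order selects P'Q + QQ' = b(P' + Q'), which is part (i), or PQ' + QQ' = (P +
     Q)Q', which is part (ii). *)
  rewrite /cfkind !(andTb, andFb, orbF, orFb); split => [o|/negbTE o]; rewrite o.
    by apply: eq_gsum => //; lia.
  by apply: eq_gsum => //; lia.
- have v : valid_cf cfs.
    move: lc; rewrite (_ : (a == 2%N) && (b == 1%N) = false) => [l|]; last by lia.
    by rewrite /valid_cf c0 pc.
  have [ea eb] := cfpq_lt v cab b0 ba a2b vc.
  have [ab bb] := bars_lt v a2b ea eb.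
  rewrite LHSsum_expo1 LHSsum_expo2 ab bb.
  have -> : Hab a b cfs L M = Hlt cfs L M.
    by rewrite /Hab a2b ifF //; lia.
  rewrite -gsum_Hlt //; last exact: core_cfgsum.
  (* Here even order gives PQ' + PP' = P(P' + Q'), part (i), and odd order gives P'Q + PP' = (P +
     Q)P', part (ii). *)
  rewrite /cfkind !(andTb, andFb, orbF, orFb); split => [/negbTE o|o]; rewrite o.
    by apply: eq_gsum => //; lia.
  by apply: eq_gsum => //; lia.
Qed.
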